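(* Let $A=\{0,1\}$ and let $(A^{\mathbb{Z}},F)$ be a one-dimensional cellular automaton of radius $r$. Then $(A^{\mathbb{Z}},F)$ is regional controllable for every $n$ if and only if the subshift of finite type $S_n(F)$ is mixing for every $n$.
   Context: A cellular automaton of radius $r\ge 1$ is given by a local rule $f:A^{2r+1}\to A$ and $F(s)_i=f(s_{i-r},\dots,s_{i+r})$. For a finite word $z\in A^{n+2r}$, $F(z)\in A^n$ denotes the word obtained by applying $f$ at the $n$ central positions. Regional controllability: let $\omega=\{c_1,\dots,c_n\}$ be a region of $n\geq 1$ consecutive cells, whose configurations are identified with words in $A^n$. A word $u\in A^n$ is reachable from $w\in A^n$ in one step if there is a boundary control $(x,y)\in (A^r)^2$ with $F(xwy)=u$, where $xwy$ is the concatenation. A word $u$ is reachable from $w$ at time $T$ if there are words $w=w^0,w^1,\dots,w^T=u$ in $A^n$ with each $w^{i+1}$ reachable from $w^i$ in one step. The CA is regional controllable on $\omega$ if for every $s^0_\omega,s^d_\omega\in A^\omega$ there is a time $T$ such that $s^d_\omega$ is reachable from $s^0_\omega$ at time $T$. It is regional controllable for every $n$ if this holds for regions of $n$ cells for every $n$. The graph $G_n(F)$ has vertex set $A^n$ and an edge from $v$ to $u$ whenever there is $(x,y)\in(A^r)^2$ with $F(xvy)=u$. $S_n(F)\subseteq (A^n)^{\mathbb{N}}$ is the one-sided subshift of finite type over the alphabet $A^n$ consisting of all infinite sequences $(v_t)_{t\in\mathbb{N}}$ such that there is an edge from $v_t$ to $v_{t+1}$ in $G_n(F)$ for all $t$.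 A subshift $\Sigma$ with language $\mathcal{L}(\Sigma)$ (the finite words appearing in its points) is mixing if for any $B,B'\in\mathcal{L}(\Sigma)$ there is $N\in\mathbb{N}$ such that for all $m\ge N$ there is a word $w\in\mathcal{L}(\Sigma)$ of length $m$ with $BwB'\in\mathcal{L}(\Sigma)$. *)

(* Defs.v *)
From mathcomp Require Import all_boot all_order all_algebra.

Set Implicit Arguments.
Unset Strict Implicit.
Unset Printing Implicit Defensive.

Import GRing.Theory.

Section CellularAutomata.

Variables (A : finType) (r : nat).

(* A cellular automaton (A^Z, F) of radius r, presented by its local rule.    *)
Record cellular_automaton := CellularAutomaton {
  ca_map :> (int -> A) -> int -> A;
  local_rule : (2 * r + 1).-tuple A -> A;
  ca_mapE : forall (s : int -> A) (i : int),
    ca_map s i = local_rule [tuple s (i - r%:Z + k%:Z)%R | k < 2 * r + 1]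
}.

Lemma window_subproof (n : nat) (i : 'I_n) (k : 'I_(2 * r + 1)) :
  i + k < r + (n + r).
Proof.
have le_k : k <= 2 * r by rewrite -ltnS -(addn1 (2 * r)) ltn_ord.
by rewrite addnCA addnn -mul2n -addSn leq_add.
Qed.

(* The window of z centred at the i-th central position, i.e. at position     *)
(* r + i of z. The length n + 2r is written r + (n + r) to match x ++ w ++ y. *)
Definition window (n : nat) (z : (r + (n + r)).-tuple A) (i : 'I_n) :
    (2 * r + 1).-tuple A :=
  [tuple tnth z (Ordinal (window_subproof i k)) | k < 2 * r + 1].

Variable F : cellular_automaton.

Definition word_map (n : nat) (z : (r + (n + r)).-tuple A) : n.-tuple A :=
  [tuple local_rule F (window z i) | i < n].

Definition reachable1 (n : nat) (w u : n.-tuple A) : Prop :=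
  exists x y : r.-tuple A, word_map [tuple of x ++ (w ++ y)] = u.

Definition reachable_at (n T : nat) (w u : n.-tuple A) : Prop :=
  exists s : nat -> n.-tuple A,
    [/\ s 0 = w, s T = u & forall i, i < T -> reachable1 (s i) (s i.+1)].

(* Configurations on a region of n consecutive cells are words of length n.   *)
Definition regional_controllable (n : nat) : Prop :=
  forall s0 sd : n.-tuple A, exists T : nat, reachable_at T s0 sd.

(* The edge relation of G_n(F), whose vertex set is n.-tuple A.               *)
Definition G_edge (n : nat) (v u : n.-tuple A) : Prop := reachable1 v u.

(* The subshift S_n(F), over the alphabet n.-tuple A.                         *)
Definition S_shift (n : nat) (v : nat -> n.-tuple A) : Prop :=
  forall t : nat, G_edge (v t) (v t.+1).

End CellularAutomata.

Section Subshifts.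

Variables (B : Type) (Sigma : (nat -> B) -> Prop).

Definition language (w : seq B) : Prop :=
  exists x : nat -> B, Sigma x /\
    exists i : nat, w = mkseq (fun k => x (i + k)) (size w).

Definition mixing : Prop :=
  forall b b' : seq B, language b -> language b' ->
    exists N : nat, forall m : nat, N <= m ->
      exists w : seq B, [/\ size w = m, language w & language (b ++ w ++ b')].

End Subshifts.

(* Main.v *)
(* The nontrivial point is that strong connectedness of all the graphs G_n
   forces each of them to be aperiodic. Given an edge v -> v' of G_n, a path of
   length T from vv to vv' in G_2n restricts on its left half to a cycle of
   length T at v, and on its right half to a path of length T from v to v'. With
   a path of length L from v' back to v, there are cycles at v of the consecutive
   lengths T + L and T + (1 + L), hence of every large enough length. Conversely,
   every word of A^n has an outgoing edge, hence is in the language of S_n, so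
   mixing provides paths between any two words. *)

Require Import Defs.
From mathcomp Require Import all_boot all_order all_algebra.

Set Implicit Arguments.
Unset Strict Implicit.
Unset Printing Implicit Defensive.

Section Glue.

Variables (B : Type) (R : B -> B -> Prop).

(** Indices count steps: the two paths share the vertex at [p], where [s p = t 0]. *)
Definition glue (p : nat) (s t : nat -> B) (k : nat) : B :=
  if k <= p then s k else t (k - p).

Lemma glue_left p s t k : k <= p -> glue p s t k = s k.
Proof. by rewrite /glue => ->. Qed.

Lemma glue_right p s t k : s p = t 0 -> glue p s t (p + k) = t k.
Proof.
move=> st; case: k => [|k]; first by rewrite addn0 glue_left.
by rewrite /glue leqNgt -addSnnS leq_addr addSnnS addKn.
Qed.

Lemma glue_step p q s t : s p = t 0 ->
    (forall i, i < p -> R (s i) (s i.+1)) ->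
    (forall i, i < q -> R (t i) (t i.+1)) ->
  forall i, i < p + q -> R (glue p s t i) (glue p s t i.+1).
Proof.
move=> st Rs Rt i lt_i; have [lt_ip | le_pi] := ltnP i p.
  by rewrite !glue_left ?(ltnW lt_ip) //; apply: Rs.
rewrite -(subnKC le_pi) -addnS !glue_right //; apply: Rt.
by rewrite ltn_subLR.
Qed.

End Glue.

(* b * q + e = b * (q - e) + b.+1 * e, with e the remainder of m modulo b. *)
Lemma consecutive_semigroup (S : nat -> Prop) (b : nat) :
    S 0 -> (forall i j, S i -> S j -> S (i + j)) -> S b -> S b.+1 ->
  forall m, b * b <= m -> S m.
Proof.
move=> S0 SD Sb Sb1 m.
have SM c k : S c -> S (k * c) by move=> Sc; elim: k => // k; apply: SD.
case: (posnP b) => [b0 _ | b_gt0 le_m].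
  (* Here [b.+1] is 1, which generates every [m]. *)
  by rewrite -[m]muln1; apply: SM; rewrite -b0.
(* The bound [b * b <= m] makes the quotient at least [b], so the difference below is not
   truncated. *)
have le_eq : m %% b <= m %/ b.
  by rewrite (leq_trans (ltnW (ltn_pmod m b_gt0))) // leq_divRL.
suff ->: m = (m %/ b - m %% b) * b + (m %% b) * b.+1 by apply: SD; apply: SM.
by rewrite mulnS addnCA -mulnDl subnK // addnC -divn_eq.
Qed.

Section Paths.

Variables (A : finType) (r : nat) (F : cellular_automaton A r).

Lemma reachable_at0 n (w : n.-tuple A) : reachable_at F 0 w w.
Proof. by exists (fun=> w). Qed.

Lemma reachable_at1 n (w u : n.-tuple A) :
  reachable1 F w u -> reachable_at F 1 w u.
Proof. by move=> wu; exists (fun i => if i is 0 then w else u); split=> // -[]. Qed.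

Lemma reachable_atD n S T (w u z : n.-tuple A) :
  reachable_at F S w u -> reachable_at F T u z -> reachable_at F (S + T) w z.
Proof.
move=> [s [s0 sS Rs]] [t [t0 tT Rt]].
have st : s S = t 0 by rewrite sS.
exists (glue S s t); split; first by rewrite glue_left.
  by rewrite glue_right.
exact: glue_step.
Qed.

(** Shift invariance moves an occurrence to the origin. *)
Lemma language_shift0 n (w : seq (n.-tuple A)) :
  language (@S_shift A r F n) w ->
  exists2 x, S_shift F x & w = mkseq x (size w).
Proof.
move=> [x [Sx [i wE]]]; exists (fun k => x (i + k)) => // k.
by rewrite addnS; apply: Sx.
Qed.

Lemma mkseq_language n (x : nat -> n.-tuple A) i m :
  S_shift F x -> language (@S_shift A r F n) (mkseq (fun k => x (i + k)) m).
Proof. by move=> Sx; exists x; split=> //; exists i; rewrite size_mkseq. Qed.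

Section Factors.

Variable a0 : A.

(** The default [a0] makes this total; it is a genuine factor once [p + n <= N]. *)
Definition factor (N n p : nat) (w : N.-tuple A) : n.-tuple A :=
  [tuple nth a0 w (p + i) | i < n].

Lemma nth_factor N n p (w : N.-tuple A) k :
  k < n -> nth a0 (factor n p w) k = nth a0 w (p + k).
Proof. by move=> lt_kn; rewrite -(tnth_nth a0 _ (Ordinal lt_kn)) tnth_mktuple. Qed.

Lemma factor_catl n (v w : n.-tuple A) : factor n 0 [tuple of v ++ w] = v.
Proof.
by apply: eq_from_tnth => i; rewrite tnth_mktuple nth_cat size_tuple ltn_ord -tnth_nth.
Qed.

Lemma factor_catr n (v w : n.-tuple A) : factor n n [tuple of v ++ w] = w.
Proof.
apply: eq_from_tnth => i.
by rewrite tnth_mktuple nth_cat size_tuple ltnNge leq_addr addKn -tnth_nth.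
Qed.

(* The cells of w adjacent to the factor act as its boundary control. *)
Lemma reachable1_factor N n p (w u : N.-tuple A) : p + n <= N ->
  reachable1 F w u -> reachable1 F (factor n p w) (factor n p u).
Proof.
move=> le_pnN [x [y <-]]; set z := [tuple of x ++ (w ++ y)].
(* The factor of [w] starts at [r + p] in [z]; these are the [r] cells on each side of it. *)
exists (factor r p z), (factor r (p + (r + n)) z).
apply: eq_from_tnth => i; rewrite !tnth_mktuple.
have lt_pi : p + i < N by rewrite (leq_trans _ le_pnN) // ltn_add2l.
rewrite -[RHS](tnth_nth a0 _ (Ordinal lt_pi)) tnth_mktuple.
congr local_rule; apply: eq_from_tnth => k; rewrite !tnth_mktuple.
rewrite !(tnth_nth a0) [in RHS]/= -addnA.
have := window_subproof i k; rewrite [X in nth _ _ X]/=.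
move: (i + k) => j lt_j; rewrite [LHS]nth_cat size_tuple.
(* In the left control, the factor or the right control, cell [j] is always cell [p + j] of [z]. *)
have [lt_jr | le_rj] := ltnP j r; first by rewrite nth_factor.
rewrite nth_cat size_tuple; have [lt_jn | le_nj] := ltnP (j - r) n.
  have le_rpj : r <= p + j by rewrite (leq_trans le_rj) ?leq_addl.
  rewrite nth_factor // !nth_cat !size_tuple ltnNge le_rpj -addnBA //=.
  by rewrite (leq_trans _ le_pnN) // ltn_add2l.
have le_rnj : r + n <= j by rewrite -leq_subRL.
rewrite nth_factor; last by rewrite -subnDA ltn_subLR // -addnA.
by rewrite -subnDA -addnA subnKC.
Qed.

Lemma reachable_at_factor N n p T (w u : N.-tuple A) : p + n <= N ->
  reachable_at F T w u -> reachable_at F T (factor n p w) (factor n p u).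
Proof.
move=> le_pnN [s [<- <- Rs]]; exists (fun i => factor n p (s i)).
by split=> // i /Rs; apply: reachable1_factor.
Qed.

(** Fixing the boundary control selects one successor of each word; iterating it gives a point of
    the subshift. *)
Definition zero_control_map n (w : n.-tuple A) : n.-tuple A :=
  word_map F [tuple of nseq r a0 ++ (w ++ nseq r a0)].

Lemma reachable1_zero_control n (w : n.-tuple A) :
  reachable1 F w (zero_control_map w).
Proof. by exists [tuple of nseq r a0], [tuple of nseq r a0]. Qed.

Lemma controllable_long_cycles n (v : n.-tuple A) :
    regional_controllable F n -> regional_controllable F (n + n) ->
  exists N, forall m, N <= m -> reachable_at F m v v.
Proof.
move=> Cn Cnn; pose v' := zero_control_map v.
have [L v'v] := Cn v' v.
have [T vv] := Cnn [tuple of v ++ v] [tuple of v ++ v'].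
have cycT : reachable_at F T v v.
  by have := reachable_at_factor (p := 0) (leq_addr n n) vv; rewrite !factor_catl.
have pathT : reachable_at F T v v'.
  by have := reachable_at_factor (leqnn (n + n)) vv; rewrite !factor_catr.
(* Lengths of cycles at [v] contain 0 and are closed under addition; here [b = T + L]. *)
exists ((T + L) * (T + L)); apply: consecutive_semigroup.
- exact: reachable_at0.
- by move=> i j; apply: reachable_atD.
- exact: reachable_atD v'v.
- rewrite -addnS -add1n; apply: reachable_atD cycT _.
  exact: reachable_atD (reachable_at1 (reachable1_zero_control v)) v'v.
Qed.

Lemma controllable_mixing n :
    regional_controllable F n -> regional_controllable F (n + n) ->
  mixing (@S_shift A r F n).
Proof.
move=> Cn Cnn b b' /language_shift0[x Sx bE] /language_shift0[x' Sx' b'E].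
(* The filler starts at [x p], the letter following [b] in [x], so [m] letters before [x' 0] amount
   to [m] steps. *)
set p := size b in bE; have [T xx'] := Cn (x p) (x' 0).
have [N cyc] := controllable_long_cycles (x p) Cn Cnn.
(* After reserving [T] steps for the path to [x' 0], at least [N] remain for a cycle at [x p]. *)
exists (N + T) => m le_m.
have [s [s0 sm Rs]] : reachable_at F m (x p) (x' 0).
  have le_Tm : T <= m by rewrite (leq_trans _ le_m) ?leq_addl.
  rewrite -(subnK le_Tm); apply: reachable_atD xx'.
  by apply: cyc; rewrite leq_subRL // addnC.
pose t := glue m s x'; pose y := glue p x t.
have t0 : x p = t 0 by rewrite /t glue_left.
have Sy : S_shift F y.
  (* [glue_step] concerns finite paths, so the length is chosen to include step [k]. *)
  move=> k; apply: (@glue_step _ (@reachable1 A r F n) p (m + k.+1)) => //.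
  - by move=> i _; apply: Sx.
  - by apply: glue_step => // i _; apply: Sx'.
  - by rewrite addnA ltn_addl.
exists (mkseq (fun k => y (p + k)) m); split; first by rewrite size_mkseq.
  exact: mkseq_language.
suff ->: b ++ mkseq (fun k => y (p + k)) m ++ b'
    = mkseq (fun k => y (0 + k)) (p + (m + size b')) by exact: mkseq_language.
rewrite /mkseq !iotaD !map_cat !add0n; congr (_ ++ (_ ++ _)).
- rewrite {1}bE; apply/eq_in_map => k; rewrite mem_iota => /= /ltnW lt_kp.
  by rewrite add0n /y glue_left.
- by rewrite -[in RHS](addn0 p) iotaDl -map_comp; apply: eq_map => k /=; rewrite add0n.
- rewrite {1}b'E -[in RHS](addn0 (p + m)) iotaDl -map_comp.
  by apply: eq_map => k /=; rewrite add0n -addnA /y glue_right // /t glue_right.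
Qed.

Lemma singleton_language n (w : n.-tuple A) :
  language (@S_shift A r F n) [:: w].
Proof.
exists (fun k => iter k (@zero_control_map n) w); split; last by exists 0.
by move=> k; apply: reachable1_zero_control.
Qed.

Lemma mixing_controllable n :
  mixing (@S_shift A r F n) -> regional_controllable F n.
Proof.
move=> mix w u.
have [N /(_ N (leqnn N)) [z [size_z _ /language_shift0[x Sx]]]] :=
  mix _ _ (singleton_language w) (singleton_language u).
rewrite size_cat size_cat size_z /= addn1 => xE.
(* The [N] letters of [z] lie between [w] at index 0 and [u] at index [N.+1]. *)
exists N.+1, x; split=> [||i _]; last exact: Sx.
  by have /(congr1 (nth w ^~ 0)) := xE; rewrite nth_mkseq.
have /(congr1 (nth w ^~ N.+1)) := xE; rewrite nth_mkseq // => <-.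
by rewrite /= nth_cat size_z ltnn subnn.
Qed.

End Factors.

End Paths.

Theorem proposition3p7 (r : nat) (hr : 0 < r) (F : cellular_automaton bool r) :
  (forall n : nat, 0 < n -> regional_controllable F n) <->
  (forall n : nat, 0 < n -> mixing (@S_shift bool r F n)).
Proof.
split=> H n n_gt0; last by apply: (mixing_controllable false); apply: H.
by apply: (controllable_mixing false); apply: H; rewrite ?addn_gt0 ?n_gt0.
Qed.
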